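(* For an exact sequence of groups $1\to H\to G\to Q\to 1$ with associated homomorphism $\Phi:Q\to\operatorname{Out}(H)$, consider the conditions: (1) $H$ is solvable; (2) $H$ is characteristic in $G$; (3) the normalizer $N_{\operatorname{Out}H}(\Phi Q)$ of $\Phi(Q)$ in $\operatorname{Out}H$ is solvable; (4) $\operatorname{Aut}(\ker\Phi)$ is solvable. If (1), (2), (3) and (4) hold, then $\operatorname{Aut}(G,H)$ is solvable. Moreover, for each $j\in\{1,2,3,4\}$ there exists an extension $1\to H\to G\to Q\to 1$ for which the three conditions other than $(j)$ hold and $\operatorname{Aut}G$ is not solvable; and for each $j\in\{2,3,4\}$ there exists an extension $1\to H\to G\to Q\to 1$ for which condition $(j)$ is false, the other three conditions hold, and $\operatorname{Aut}G$ is solvable.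
   Context: $H$ is identified with its image, a normal subgroup of $G$. $\Phi(q)\in\operatorname{Out}(H)$ is the class of the automorphism of $H$ given by conjugation by any preimage of $q$ in $G$. $\operatorname{Aut}(G,H)$ is the group of automorphisms of $G$ that restrict to an automorphism of $H$. *)

(* Defs.v *)
From HB Require Import structures.
From mathcomp Require Import all_boot generic_quotient.
From mathcomp Require Import boolp classical_sets.

Set Implicit Arguments.
Unset Strict Implicit.
Unset Printing Implicit Defensive.

Local Open Scope classical_set_scope.
Local Open Scope group_scope.
Local Open Scope quotient_scope.

(* Groups are arbitrary, possibly infinite [groupType]s; subgroups are classical
   sets.  The [choiceType] structure underlying [groupType] is no restriction,
   since [boolp] provides one for every type. *)

Notation "{ 'hom' G -> H }" := (UMagmaMorphism.type G%type H%type)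
  (at level 0, G at level 98, H at level 99, format "{ 'hom'  G  ->  H }") :
  type_scope.

Lemma hom_morphism (G K : groupType) (f : G -> K) :
  {morph f : x y / x * y} -> monoid_morphism f.
Proof.
by move=> fM; split=> //; apply: (@mulgI _ (f 1)); rewrite -fM !mulg1.
Qed.

Section Subgroups.
Variable G : groupType.
Implicit Types A B : set G.

Definition is_subgroup A : Prop := A 1 /\ forall x y, A x -> A y -> A (x / y).

Definition generated_subgroup A : set G := smallest is_subgroup A.

Definition derived_subgroup A : set G :=
  generated_subgroup [set [~ x, y] | x in A & y in A].

Definition is_solvable A : Prop :=
  exists n, iter n derived_subgroup A = [set 1].

Definition normalizer A : set G := [set x | [set y ^ x | y in A] = A].

End Subgroups.

Definition solvable_group (G : groupType) : Prop := is_solvable [set: G].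

Section Kernel.
Variables (G K : groupType) (f : {hom G -> K}).

Definition hom_ker : set G := [set x | f x = 1].

Definition hom_ker_group : Type := {x : G | x \in hom_ker}.

Lemma hom_ker_group_closed : group_closed (fun x : G => x \in hom_ker).
Proof.
split=> [|x y]; first by rewrite unfold_in; apply/mem_set; exact: gmulf1.
rewrite !unfold_in => /set_mem /= fx /set_mem /= fy.
by apply/mem_set; rewrite /hom_ker /= gmulfF fx fy mulgV.
Qed.

HB.instance Definition _ := SubChoice.on hom_ker_group.
HB.instance Definition _ :=
  SubChoice_isSubGroup.Build G (fun x : G => x \in hom_ker) hom_ker_group
    hom_ker_group_closed.

End Kernel.

Section Automorphisms.
Variable G : groupType.

Record group_aut : Type := GroupAut {
  aut_fun :> G -> G;
  group_autM : {morph aut_fun : x y / x * y};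
  aut_bij : bijective aut_fun }.

HB.instance Definition _ := gen_eqMixin group_aut.
HB.instance Definition _ := gen_choiceMixin group_aut.

HB.instance Definition _ (f : group_aut) :=
  isUMagmaMorphism.Build G G (aut_fun f) (hom_morphism (group_autM f)).

Lemma autP (f g : group_aut) : f =1 g -> f = g.
Proof.
case: f g => [f fM fB] [g gM gB] /= /funext fg; subst g.
by congr GroupAut; exact: Prop_irrelevance.
Qed.

Definition aut_one : group_aut :=
  @GroupAut idfun (fun _ _ => erefl) (Bijective (frefl _) (frefl _)).

Lemma aut_mul_morph (f g : group_aut) : {morph f \o g : x y / x * y}.
Proof. by move=> x y /=; rewrite !group_autM. Qed.

Definition aut_mul (f g : group_aut) : group_aut :=
  GroupAut (aut_mul_morph f g) (bij_comp (aut_bij f) (aut_bij g)).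

Lemma aut_inv_ex (f : group_aut) : exists g : G -> G, cancel f g /\ cancel g f.
Proof. by case: (aut_bij f) => g fg gf; exists g. Qed.

Definition aut_inv_fun (f : group_aut) : G -> G := sval (cid (aut_inv_ex f)).

Lemma aut_funK (f : group_aut) : cancel f (aut_inv_fun f).
Proof. exact: (svalP (cid (aut_inv_ex f))).1. Qed.

Lemma aut_inv_funK (f : group_aut) : cancel (aut_inv_fun f) f.
Proof. exact: (svalP (cid (aut_inv_ex f))).2. Qed.

Lemma aut_inv_morph (f : group_aut) : {morph aut_inv_fun f : x y / x * y}.
Proof.
by move=> x y; apply: (can_inj (aut_funK f)); rewrite group_autM !aut_inv_funK.
Qed.

Definition aut_inv (f : group_aut) : group_aut :=
  GroupAut (aut_inv_morph f) (Bijective (aut_inv_funK f) (aut_funK f)).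

Lemma aut_mulA : associative aut_mul.
Proof. by move=> f g h; apply: autP. Qed.

Lemma aut_mul1g : left_id aut_one aut_mul.
Proof. by move=> f; apply: autP. Qed.

Lemma aut_mulg1 : right_id aut_one aut_mul.
Proof. by move=> f; apply: autP. Qed.

Lemma aut_mulVg : left_inverse aut_one aut_inv aut_mul.
Proof. by move=> f; apply: autP => x; exact: aut_funK. Qed.

Lemma aut_mulgV : right_inverse aut_one aut_inv aut_mul.
Proof. by move=> f; apply: autP => x; exact: aut_inv_funK. Qed.

HB.instance Definition _ :=
  isGroup.Build group_aut aut_mulA aut_mul1g aut_mulg1 aut_mulVg aut_mulgV.

Lemma aut_mulE (f g : group_aut) x : (f * g) x = f (g x).
Proof. by []. Qed.

Lemma aut_oneE x : (1 : group_aut) x = x.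
Proof. by []. Qed.

Definition is_characteristic (A : set G) : Prop :=
  forall f : group_aut, [set f x | x in A] = A.

(* [x |-> g * x * g^-1], so that [inner] is a homomorphism for [aut_mul]. *)
Definition inner_fun (g x : G) : G := g * x / g.

Lemma inner_funK g : cancel (inner_fun g) (inner_fun g^-1).
Proof. by move=> x; rewrite /inner_fun invgK !mulgA mulVg mul1g mulgVK. Qed.

Lemma inner_funVK g : cancel (inner_fun g^-1) (inner_fun g).
Proof. by move=> x; rewrite /inner_fun invgK !mulgA mulgV mul1g mulgK. Qed.

Lemma inner_morph g : {morph inner_fun g : x y / x * y}.
Proof. by move=> x y; rewrite /inner_fun !mulgA mulgVK. Qed.

Definition inner (g : G) : group_aut :=
  GroupAut (inner_morph g) (Bijective (inner_funK g) (inner_funVK g)).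

Definition Inn : set group_aut := range inner.

Lemma innerM : {morph inner : x y / x * y}.
Proof.
by move=> x y; apply: autP => z; rewrite aut_mulE /= /inner_fun invgM !mulgA.
Qed.

HB.instance Definition _ :=
  isUMagmaMorphism.Build G group_aut inner (hom_morphism innerM).

Lemma innerJ (f : group_aut) g : f * inner g / f = inner (f g).
Proof.
apply: autP => z; rewrite !aut_mulE /= /inner_fun !group_autM.
by rewrite aut_inv_funK; congr (_ * _ * _); exact: gmulfV.
Qed.

Definition out_rel (f g : group_aut) : bool := `[< Inn (f / g) >].

Lemma out_rel_refl : reflexive out_rel.
Proof. by move=> f; apply/asboolP; exists 1 => //; rewrite mulgV gmulf1. Qed.

Lemma out_rel_sym : symmetric out_rel.
Proof.
have h f g : out_rel f g -> out_rel g f.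
  move=> /asboolP[x _ xE]; apply/asboolP; exists x^-1 => //.
  by rewrite -invgF -xE; exact: gmulfV.
by move=> f g; apply/idP/idP; exact: h.
Qed.

Lemma out_rel_trans : transitive out_rel.
Proof.
move=> g f h /asboolP[x _ xE] /asboolP[y _ yE]; apply/asboolP.
by exists (x * y) => //; rewrite innerM xE yE mulgA mulgVK.
Qed.

Canonical out_equiv := EquivRel out_rel out_rel_refl out_rel_sym out_rel_trans.

Definition group_out : Type := {eq_quot out_equiv}.

HB.instance Definition _ := Choice.on group_out.

Definition to_out (f : group_aut) : group_out := \pi_{eq_quot out_equiv} f.

Lemma to_outP (f g : group_aut) : to_out f = to_out g <-> Inn (f / g).
Proof.
split=> [/eqmodP/asboolP //|fg].
by apply/eqmodP; apply/asboolP.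
Qed.

Definition out_repr (a : group_out) : group_aut :=
  repr (a : {eq_quot out_equiv}).

Lemma out_reprK : cancel out_repr to_out.
Proof. by move=> a; exact: reprK. Qed.

Definition out_one : group_out := to_out 1.
Definition out_mul (a b : group_out) : group_out :=
  to_out (out_repr a * out_repr b).
Definition out_inv (a : group_out) : group_out := to_out (out_repr a)^-1.

Lemma to_out_mul (f g : group_aut) :
  to_out (f * g) = out_mul (to_out f) (to_out g).
Proof.
have /to_outP[x _ xE] := out_reprK (to_out f).
have /to_outP[y _ yE] := out_reprK (to_out g).
set f' := out_repr _ in xE *; set g' := out_repr _ in yE *.
have f'E : f' = inner x * f by rewrite xE mulgVK.
have g'E : g' = inner y * g by rewrite yE mulgVK.
rewrite /out_mul -/f' -/g'; apply/esym/to_outP; exists (x * f y) => //.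
by rewrite f'E g'E innerM -innerJ !invgM !mulgA mulgK.
Qed.

Lemma to_out_inv (f : group_aut) : to_out f^-1 = out_inv (to_out f).
Proof.
have /to_outP[x _ xE] := out_reprK (to_out f).
set f' := out_repr _ in xE *.
have f'E : f' = inner x * f by rewrite xE mulgVK.
rewrite /out_inv -/f'; apply/to_outP; exists (f^-1 x) => //.
by rewrite -innerJ f'E !invgK mulgA.
Qed.

Lemma out_mulA : associative out_mul.
Proof.
move=> a b c; rewrite -[a]out_reprK -[b]out_reprK -[c]out_reprK.
by rewrite -!to_out_mul mulgA.
Qed.

Lemma out_mul1g : left_id out_one out_mul.
Proof. by move=> a; rewrite -[a]out_reprK -to_out_mul mul1g. Qed.

Lemma out_mulg1 : right_id out_one out_mul.
Proof. by move=> a; rewrite -[a]out_reprK -to_out_mul mulg1. Qed.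

Lemma out_mulVg : left_inverse out_one out_inv out_mul.
Proof.
by move=> a; rewrite -[a]out_reprK -to_out_inv -to_out_mul mulVg.
Qed.

Lemma out_mulgV : right_inverse out_one out_inv out_mul.
Proof.
by move=> a; rewrite -[a]out_reprK -to_out_inv -to_out_mul mulgV.
Qed.

HB.instance Definition _ :=
  isGroup.Build group_out out_mulA out_mul1g out_mulg1 out_mulVg out_mulgV.

HB.instance Definition _ :=
  isUMagmaMorphism.Build group_aut group_out to_out (hom_morphism to_out_mul).

End Automorphisms.

Section Extensions.
Variables H G Q : groupType.

Record extension : Type := Extension {
  incl : {hom H -> G};
  proj : {hom G -> Q};
  incl_inj : injective incl;
  proj_surj : forall q, exists g, proj g = q;
  ext_exact : range incl = hom_ker proj }.

Variable E : extension.

Lemma ext_conj_ex (g : G) (h : H) :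
  exists h' : H, incl E h' = inner g (incl E h).
Proof.
have : hom_ker (proj E) (inner g (incl E h)).
  have : hom_ker (proj E) (incl E h) by rewrite -ext_exact; exists h.
  by rewrite /hom_ker /= /inner_fun => e; rewrite gmulfF gmulfM e mulg1 mulgV.
by rewrite -ext_exact => -[h' _ h'E]; exists h'.
Qed.

Definition ext_conj_fun (g : G) (h : H) : H := sval (cid (ext_conj_ex g h)).

Lemma ext_conj_funE g h : incl E (ext_conj_fun g h) = g * incl E h / g.
Proof. exact: (svalP (cid (ext_conj_ex g h))). Qed.

Lemma ext_conj_morph g : {morph ext_conj_fun g : x y / x * y}.
Proof.
move=> x y; apply: (@incl_inj E).
by rewrite gmulfM !ext_conj_funE gmulfM !mulgA mulgVK.
Qed.

Lemma ext_conj_funK g : cancel (ext_conj_fun g) (ext_conj_fun g^-1).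
Proof.
move=> x; apply: (@incl_inj E); rewrite !ext_conj_funE.
exact: inner_funK.
Qed.

Lemma ext_conj_funVK g : cancel (ext_conj_fun g^-1) (ext_conj_fun g).
Proof.
move=> x; apply: (@incl_inj E); rewrite !ext_conj_funE.
exact: inner_funVK.
Qed.

Definition ext_conj (g : G) : group_aut H :=
  GroupAut (ext_conj_morph g) (Bijective (ext_conj_funK g) (ext_conj_funVK g)).

Lemma ext_conjM : {morph ext_conj : x y / x * y}.
Proof.
move=> x y; apply: autP => h; apply: (@incl_inj E).
by rewrite aut_mulE /= !ext_conj_funE invgM !mulgA.
Qed.

Lemma ext_conj_incl (h : H) : ext_conj (incl E h) = inner h.
Proof.
apply: autP => x; apply: (@incl_inj E).
by rewrite /= ext_conj_funE /inner_fun gmulfF gmulfM.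
Qed.

(* The preimage of [q] is chosen; [Phi_proj] shows that any other one gives the
   same class. *)
Definition Phi (q : Q) : group_out H :=
  to_out (ext_conj (sval (cid (proj_surj E q)))).

Lemma Phi_proj (g : G) : Phi (proj E g) = to_out (ext_conj g).
Proof.
rewrite /Phi; case: cid => g' /= g'E; apply/to_outP.
have : hom_ker (proj E) (g' / g) by rewrite /hom_ker /= gmulfF g'E mulgV.
rewrite -ext_exact => -[h _ hE]; exists h => //.
rewrite -ext_conj_incl hE; apply: (canRL (mulgK _)).
by rewrite -ext_conjM mulgVK.
Qed.

Lemma PhiM : {morph Phi : p q / p * q}.
Proof.
move=> p q; have [x <-] := proj_surj E p; have [y <-] := proj_surj E q.
by rewrite -gmulfM !Phi_proj ext_conjM gmulfM.
Qed.

HB.instance Definition _ :=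
  isUMagmaMorphism.Build Q (group_out H) Phi (hom_morphism PhiM).

Definition Aut_pair : set (group_aut G) :=
  [set f : group_aut G | [set f x | x in range (incl E)] = range (incl E)].

Definition condition (j : nat) : Prop :=
  match j with
  | 1 => solvable_group H
  | 2 => is_characteristic (range (incl E))
  | 3 => is_solvable (normalizer (range Phi))
  | 4 => solvable_group (group_aut (hom_ker_group Phi))
  | _ => True
  end.

End Extensions.

(* Main.v *)
Require Import Defs.
From HB Require Import structures.
From mathcomp Require all_fingroup all_solvable.
From mathcomp Require Import all_boot all_algebra all_field.
From mathcomp Require Import boolp classical_sets.

Set Implicit Arguments.
Unset Strict Implicit.
Unset Printing Implicit Defensive.

(** The solvability statement is a dévissage of [Aut(G, H)]. Restricting an
    automorphism [f] to [H] gives a class in [Out H]; since [f] transports the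
    conjugation action of [g] on [H] to that of [f g], this class normalises the
    image of [Phi]. On the kernel of that map [f] acts on [H] by an inner
    automorphism, so the automorphism [b] induced on [Q] satisfies
    [Phi (b q) = Phi q]; in particular [b] acts on [ker Phi], and trivially on
    [Q / ker Phi]. Killing the action on [ker Phi] leaves automorphisms of [Q] that
    are trivial on a normal subgroup and on its quotient, and these commute
    ([stabilizer_commute]). Killing [b] as well leaves an action on [H] through
    [Inn H], a quotient of the solvable group [H]; killing that leaves
    automorphisms of [G] trivial on [H] and on [G / H], which commute for the same
    reason. Each step is an instance of [solvable_rel].

    All examples except one have [G] abelian. Then [Phi] is trivial, so that [H] is
    solvable, the normaliser is the whole of [Out H = Aut H], and [ker Phi = Q]:
    the last two conditions say that [Aut H] and [Aut Q] are solvable. Let [C] be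
    cyclic of order 7, [D] the group of complex roots of unity, [Z] the integers.
    Automorphism groups of [C], [D] and [Z] are abelian, while
    [Aut (C * C) = GL_2(7)] is not solvable ([not_solvable_aut_square]). Hence
    [Aut G] is not solvable for
      [C -> C * C -> C], where [H] is not characteristic,
      [C * C -> C * C -> 1], where the normaliser is not solvable,
      [1 -> C * C -> C * C], where [Aut (ker Phi)] is not solvable.
    On the other hand [Aut (D * C)] and [Aut (Z * C)] are solvable by the first
    part, applied to the characteristic subgroup [D] of seventh powers, respectively
    to the torsion subgroup [C]. They serve for
      [C -> D * C -> D], where [H] is moved by the embedding of [C] in [D],
      [C * C -> D * C -> D], the kernel of the seventh power map,
      [Z -> Z * C -> C * C], whose image is that of the seventh power map.

    The remaining example, with [H] not solvable, needs [H] nonsolvable but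
    [Out H] under control. For [S] nonabelian simple, [Aut S] is complete, that is,
    every automorphism of [Aut S] is inner ([aut_Aut_inner]); so
    [Aut S -> Aut S -> 1] has trivial [Out H]. The alternating group on five
    letters provides such an [S]. *)

(** * Solvable subsets and relational homomorphisms *)

Section Solvability.
Local Open Scope classical_set_scope.
Local Open Scope group_scope.

Lemma generated_sub (G : groupType) (A : set G) : A `<=` generated_subgroup A.
Proof. by move=> x Ax B [_]; apply. Qed.

Lemma generated_min (G : groupType) (A B : set G) :
  is_subgroup B -> A `<=` B -> generated_subgroup A `<=` B.
Proof. by move=> sB AB x; apply. Qed.

Lemma generated_is_subgroup (G : groupType) (A : set G) :
  is_subgroup (generated_subgroup A).
Proof.
split=> [B [[]//]|x y Ax Ay B sB].
by case: (sB) => -[_ +] _; apply; [apply: Ax | apply: Ay].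
Qed.

Lemma subgroupV (G : groupType) (A : set G) x : is_subgroup A -> A x -> A x^-1.
Proof. by move=> [A1 AF] Ax; rewrite -[_^-1]mul1g; apply: AF. Qed.

Lemma subgroupM (G : groupType) (A : set G) x y :
  is_subgroup A -> A x -> A y -> A (x * y).
Proof.
by move=> sA Ax Ay; rewrite -[y]invgK; apply: sA.2 => //; apply: subgroupV.
Qed.

Lemma subgroupR (G : groupType) (A : set G) x y :
  is_subgroup A -> A x -> A y -> A [~ x, y].
Proof.
move=> sA Ax Ay; rewrite /commg /conjg.
by do ![apply: subgroupM | apply: subgroupV | apply: Ax | apply: Ay].
Qed.

Lemma subgroup1 (G : groupType) : is_subgroup [set (1 : G)].
Proof. by split=> // x y -> ->; rewrite mulgV. Qed.

Lemma iter_derived_is_subgroup (G : groupType) (A : set G) n :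
  is_subgroup A -> is_subgroup (iter n (@derived_subgroup G) A).
Proof. by case: n => [//|n] _; apply: generated_is_subgroup. Qed.

Lemma derived_commg (G : groupType) (A : set G) x y :
  A x -> A y -> derived_subgroup A [~ x, y].
Proof. by move=> Ax Ay; apply: generated_sub; exists x => //; exists y. Qed.

Lemma derived_min (G : groupType) (A B : set G) :
  is_subgroup B -> (forall x y, A x -> A y -> B [~ x, y]) ->
  derived_subgroup A `<=` B.
Proof.
by move=> sB AB; apply: generated_min => // _ [x Ax [y Ay <-]]; apply: AB.
Qed.

Lemma iter_derived_sub (G : groupType) (A : set G) n :
  is_subgroup A -> iter n (@derived_subgroup G) A `<=` A.
Proof.
move=> sA; elim: n => [//|n IH] /=; apply: derived_min => // x y Ax Ay.
by apply: subgroupR => //; apply: IH.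
Qed.

Lemma iter_derivedS (G : groupType) (A B : set G) n :
  A `<=` B ->
  iter n (@derived_subgroup G) A `<=` iter n (@derived_subgroup G) B.
Proof.
move=> AB; elim: n => [//|n IH] /=.
apply: derived_min => [|x y Ax Ay]; first exact: generated_is_subgroup.
by apply: derived_commg; apply: IH.
Qed.

Lemma is_solvableP (G : groupType) (A : set G) :
  is_solvable A <-> exists n, iter n (@derived_subgroup G) A `<=` [set 1].
Proof.
split=> [[n <-]|[n An]]; first by exists n.
exists n.+1 => /=; rewrite eqEsubset; split.
  apply: derived_min => [|x y /An -> /An ->]; first exact: subgroup1.
  by rewrite /= comm1g.
by move=> _ ->; apply: (generated_is_subgroup _).1.
Qed.

Lemma solvableS (G : groupType) (A B : set G) :
  A `<=` B -> is_solvable B -> is_solvable A.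
Proof.
move=> AB /is_solvableP[n Bn]; apply/is_solvableP; exists n.
by apply: subset_trans Bn; apply: iter_derivedS.
Qed.

Lemma solvable_commute (G : groupType) (A : set G) :
  (forall x y, A x -> A y -> x * y = y * x) -> is_solvable A.
Proof.
move=> cA; apply/is_solvableP; exists 1%N; apply: derived_min.
  exact: subgroup1.
by move=> x y Ax Ay /=; apply/eqP/commgP; apply: cA.
Qed.

(** A homomorphism is presented by its graph, that is, by a subgroup of [G * K]. The
    maps used below are only defined on a subgroup and involve choices (a
    restriction, an induced automorphism, an element realising an inner
    automorphism); as relations they need neither a default value nor a proof that
    the choice is unique. *)
Definition rel_hom (G K : groupType) (R : G -> K -> Prop) : Prop :=
  R 1 1 /\ forall x x' y y', R x y -> R x' y' -> R (x / x') (y / y').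

(** A commutator is a word in its entries, hence related to the commutator of any
    entries related to them. *)
Lemma rel_hom_iter_derived (G K : groupType) (R : G -> K -> Prop) A B n :
  rel_hom R -> (forall x, A x -> exists2 y, B y & R x y) ->
  forall x, iter n (@derived_subgroup G) A x ->
    exists2 y, iter n (@derived_subgroup K) B y & R x y.
Proof.
move=> [R1 RF] AB; elim: n => [//|n IH] /=.
have RV x y : R x y -> R x^-1 y^-1.
  by move=> Rxy; rewrite -[x^-1]mul1g -[y^-1]mul1g; apply: RF.
have RM x y x' y' : R x y -> R x' y' -> R (x * x') (y * y').
  by move=> Rxy /RV Rxy'; rewrite -[x']invgK -[y']invgK; apply: RF.
set D := derived_subgroup (iter n _ B).
have sD : is_subgroup D by apply: generated_is_subgroup.
apply: (@derived_min _ _ [set x | exists2 y, D y & R x y]); first split.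
- by exists 1 => //; apply: sD.1.
- move=> x x' [y Dy Rxy] [y' Dy' Rxy']; exists (y / y'); last exact: RF.
  exact: sD.2.
move=> x x' /IH[y By Rxy] /IH[y' By' Rxy']; exists [~ y, y'].
  exact: derived_commg.
rewrite /commg /conjg; apply: (RM) (RV _ _ Rxy) _.
by apply: (RM) (RV _ _ Rxy') _; apply: RM.
Qed.

(** An extension of a solvable group by a solvable group is solvable: once the
    derived series of [B] has reached 1, that of [A] has reached the kernel. *)
Lemma solvable_rel (G K : groupType) (R : G -> K -> Prop)
    (A : set G) (B : set K) :
  rel_hom R -> is_subgroup A -> (forall x, A x -> exists2 y, B y & R x y) ->
  is_solvable B -> is_solvable [set x | A x /\ R x 1] -> is_solvable A.
Proof.
move=> hR sA AB /is_solvableP[n Bn] /is_solvableP[m Cm].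
apply/is_solvableP; exists (m + n)%N; rewrite iterD.
apply: subset_trans Cm; apply: iter_derivedS => x Dx.
split; first exact: iter_derived_sub Dx.
by have [y /Bn -> Rx1] := rel_hom_iter_derived hR AB Dx.
Qed.

Lemma solvable_embed (G K : groupType) (f : G -> K) (B : set K) :
  {morph f : x y / x * y} -> injective f -> (forall x, B (f x)) ->
  is_solvable B -> solvable_group G.
Proof.
move=> fM fI fB; have [f1 _] := hom_morphism fM.
pose F : {hom G -> K} :=
  HB.pack f (isUMagmaMorphism.Build G K f (hom_morphism fM)).
move=> sB; apply: (@solvable_rel _ _ (fun x y => f x = y) [set: G] B) => //.
- split=> // x x' _ _ <- <-; exact: (gmulfF F).
- by move=> x _; exists (f x).
apply: solvable_commute => x y [_ fx] [_ fy].
by rewrite (_ : x = 1) ?mul1g ?mulg1 //; apply: fI; rewrite fx f1.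
Qed.

End Solvability.

(** * Automorphisms trivial on a normal subgroup and on its quotient *)

Section AutTools.
Local Open Scope classical_set_scope.
Local Open Scope group_scope.

Definition hom_of (G K : groupType) (f : G -> K)
    (fM : {morph f : x y / x * y}) : {hom G -> K} :=
  HB.pack f (isUMagmaMorphism.Build G K f (hom_morphism fM)).

Lemma autK (G : groupType) (f : group_aut G) : cancel f (f^-1).
Proof. exact: aut_funK. Qed.

Lemma autVK (G : groupType) (f : group_aut G) : cancel (f^-1) f.
Proof. exact: aut_inv_funK. Qed.

Lemma aut_inj (G : groupType) (f : group_aut G) : injective f.
Proof. exact: can_inj (autK f). Qed.

Lemma autV (G : groupType) (f : group_aut G) x : f x^-1 = (f x)^-1.
Proof. exact: (gmulfV f). Qed.

Lemma autF (G : groupType) (f : group_aut G) x y : f (x / y) = f x / f y.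
Proof. by rewrite group_autM autV. Qed.

Lemma aut1 (G : groupType) (f : group_aut G) : f 1 = 1.
Proof. exact: (hom_morphism (group_autM f)).1. Qed.

(** Write [f x = k * x] and [g x = m * x] with [k] and [m] in [N]. Then [f] fixes
    both [m] and [x^-1 * m * x], and comparing [f (x^-1 * m * x)] with its
    factorwise image shows that [k] commutes with [m]. Since [f (g x) = m * k * x]
    and [g (f x) = k * m * x], this is what is needed. *)
Lemma stabilizer_commute (G : groupType) (N : set G) (f g : group_aut G) :
  is_subgroup N -> (forall x n, N n -> N (x * n / x)) ->
  (forall n, N n -> f n = n) -> (forall n, N n -> g n = n) ->
  (forall x, N (f x / x)) -> (forall x, N (g x / x)) ->
  f * g = g * f.
Proof.
move=> sN nN fN gN fQ gQ; apply: autP => x; rewrite !aut_mulE.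
move: (fQ x) (gQ x); set k := f x / x; set m := g x / x => Nk Nm.
have fE : f x = k * x by rewrite mulgVK.
have gE : g x = m * x by rewrite mulgVK.
move: k m fE gE Nk Nm => k m fE gE Nk Nm.
rewrite gE fE !group_autM (fN _ Nm) (gN _ Nk) fE gE !mulgA; congr (_ * _).
have Nmx : N (x^-1 * m * x) by rewrite -[X in _ * X]invgK; apply: nN.
have := fN _ Nmx; rewrite 2!group_autM (fN m Nm) autV fE invgM.
move=> /(congr1 (fun z => k * (x * z / x))).
by rewrite !mulgA !(mulgVK, mulgK) mulgV mul1g.
Qed.

End AutTools.

(** * Solvability of the automorphism group of a pair *)

Section AutPairSolvable.
Local Open Scope classical_set_scope.
Local Open Scope group_scope.

(** Used with [p] injective for the restriction of an automorphism to a subgroup, and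
    with [p] surjective for the automorphism induced on a quotient. *)
Definition intertwines (X Y : groupType) (p : X -> Y) (f : group_aut X)
    (g : group_aut Y) : Prop :=
  forall x, p (f x) = g (p x).

Lemma intertwinesF (X Y : groupType) (p : X -> Y) f f' g g' :
  intertwines p f g -> intertwines p f' g' -> intertwines p (f / f') (g / g').
Proof.
move=> fg fg' x; rewrite !aut_mulE fg; congr (g _).
by apply: (@aut_inj _ g'); rewrite -fg' !autVK.
Qed.

Lemma aut_restrict (X Y : groupType) (i : {hom X -> Y}) (g : group_aut Y) :
  injective i -> (forall x, exists x', i x' = g (i x)) ->
  (forall x, exists x', i x' = g^-1 (i x)) ->
  exists f : group_aut X, intertwines i f g.
Proof.
move=> iI /choice[a aE] /choice[b bE].
have aM : {morph a : x y / x * y}.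
  by move=> x y; apply: iI; rewrite aE gmulfM group_autM -!aE -gmulfM.
have ab : cancel a b by move=> x; apply: iI; rewrite bE aE autK.
have ba : cancel b a by move=> x; apply: iI; rewrite aE bE autVK.
by exists (GroupAut aM (Bijective ab ba)).
Qed.

Lemma aut_quotient (X Y : groupType) (p : {hom X -> Y}) (f : group_aut X) :
  (forall y, exists x, p x = y) -> (forall x, p x = 1 -> p (f x) = 1) ->
  (forall x, p x = 1 -> p (f^-1 x) = 1) ->
  exists g : group_aut Y, intertwines p f g.
Proof.
move=> /choice[s sE] fk fVk.
have eqp (h : group_aut X) : (forall x, p x = 1 -> p (h x) = 1) ->
    forall x y, p x = p y -> p (h x) = p (h y).
  move=> hk x y pxy; apply/eqP; rewrite -divg_eq1 -gmulfF -autF.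
  by apply/eqP/hk; rewrite gmulfF pxy mulgV.
pose a y := p (f (s y)); pose b y := p (f^-1 (s y)).
have aM : {morph a : x y / x * y}.
  move=> x y; rewrite /a -gmulfM -group_autM.
  by apply: eqp => //; rewrite gmulfM !sE.
have ab : cancel a b.
  move=> y; rewrite /a /b -[RHS]sE -[s y in RHS](autK f (s y)).
  by apply: eqp => //; rewrite sE.
have ba : cancel b a.
  move=> y; rewrite /a /b -[RHS]sE -[s y in RHS](autVK f (s y)).
  by apply: eqp => //; rewrite sE.
exists (GroupAut aM (Bijective ab ba)) => x /=.
by apply: eqp => //; rewrite sE.
Qed.

Lemma rel_hom_ker_subgroup (X Y : groupType) (R : X -> Y -> Prop) (A : set X) :
  rel_hom R -> is_subgroup A -> is_subgroup [set x | A x /\ R x 1].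
Proof.
move=> [R1 RF] [A1 AF]; split=> // x y [Ax Rx] [Ay Ry].
by split; [apply: AF | rewrite -[X in R _ X](mulgV 1); apply: RF].
Qed.

Variables (H G Q : groupType) (E : extension H G Q).

Lemma Aut_pairP (f : group_aut G) :
  Aut_pair E f <-> (forall h, exists h', incl E h' = f (incl E h)) /\
                   (forall h, exists h', incl E h' = f^-1 (incl E h)).
Proof.
split=> [fE|[fi fVi]].
  split=> h.
    have : [set f x | x in range (incl E)] (f (incl E h)).
      by exists (incl E h) => //; exists h.
    by rewrite fE => -[h' _]; exists h'.
  have : range (incl E) (incl E h) by exists h.
  by rewrite -fE => -[_ [h' _ <-] <-]; exists h'; rewrite autK.
rewrite /Aut_pair /= eqEsubset; split=> [_ [_ [h _ <-] <-]|_ [h _ <-]].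
  by have [h' <-] := fi h; exists h'.
have [h' h'E] := fVi h; exists (incl E h'); first by exists h'.
by rewrite h'E autVK.
Qed.

Lemma Aut_pair_subgroup : is_subgroup (Aut_pair E).
Proof.
split=> [|f g /Aut_pairP[fi fVi] /Aut_pairP[gi gVi]]; apply/Aut_pairP.
  by split=> h; exists h; rewrite ?invg1.
split=> h.
  have [h' h'E] := gVi h; have [k kE] := fi h'; exists k.
  by rewrite aut_mulE kE h'E.
have [h' h'E] := fVi h; have [k kE] := gi h'; exists k.
by rewrite invgF aut_mulE kE h'E.
Qed.

Lemma proj_incl h : proj E (incl E h) = 1.
Proof.
by have : range (incl E) (incl E h) by [exists h]; rewrite ext_exact.
Qed.

Lemma proj_eq1 g : proj E g = 1 -> exists h, incl E h = g.
Proof.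
move=> g1; have : hom_ker (proj E) g by [].
by rewrite -ext_exact => -[h _]; exists h.
Qed.

Lemma Aut_pair_incl f : Aut_pair E f ->
  exists a : group_aut H, intertwines (incl E) a f.
Proof. by move=> /Aut_pairP[]; apply: aut_restrict; apply: incl_inj. Qed.

Lemma Aut_pair_proj f : Aut_pair E f ->
  exists b : group_aut Q, intertwines (proj E) f b.
Proof.
move=> /Aut_pairP[fi fVi]; apply: aut_quotient => [|g|g]; first exact: proj_surj.
  by move=> /proj_eq1[h <-]; have [h' <-] := fi h; rewrite proj_incl.
by move=> /proj_eq1[h <-]; have [h' <-] := fVi h; rewrite proj_incl.
Qed.

Lemma PhiF p q : Phi E (p / q) = Phi E p / Phi E q.
Proof. exact: gmulfF. Qed.

(** The compatibility behind the whole argument: [f] carries conjugation by [g] on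
    [H] to conjugation by [f g]. *)
Lemma Phi_intertwines f (a : group_aut H) (b : group_aut Q) q :
  intertwines (incl E) a f -> intertwines (proj E) f b ->
  Phi E (b q) = to_out a * Phi E q / to_out a.
Proof.
move=> af fb; have [g <-] := proj_surj E q.
apply: (canRL (mulgK _)); rewrite -fb !Phi_proj -!gmulfM; congr to_out.
apply: autP => h; apply: (@incl_inj _ _ _ E).
by rewrite !aut_mulE /= ext_conj_funE !af /= ext_conj_funE autF group_autM.
Qed.

(** The kernels of [R1], [R2], the action on [Q] and [R3] are peeled off in this
    order. *)
Lemma solvable_Aut_pair :
  condition E 1 -> condition E 3 -> condition E 4 -> is_solvable (Aut_pair E).
Proof.
rewrite /condition => solH solN solK.
pose R1 (f : group_aut G) (o : group_out H) :=
  exists2 a, intertwines (incl E) a f & to_out a = o.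
pose R2 (f : group_aut G) (k : group_aut (hom_ker_group (Phi E))) :=
  exists2 b, intertwines (proj E) f b & intertwines val k b.
pose R3 (f : group_aut G) h := intertwines (incl E) (inner h) f.
have hR1 : rel_hom R1.
  split; first by exists 1 => //; apply: gmulf1.
  move=> f f' _ _ [a af <-] [a' af' <-]; exists (a / a').
    exact: intertwinesF.
  exact: gmulfF.
have hR2 : rel_hom R2.
  split; first by exists 1.
  move=> f f' k k' [b fb kb] [b' fb' kb']; exists (b / b');
    exact: intertwinesF.
have hRp : rel_hom (intertwines (proj E)).
  by split=> // *; apply: intertwinesF.
have hR3 : rel_hom R3.
  split=> [h|f f' h h' fh fh']; first by rewrite gmulf1.
  by rewrite /R3 gmulfF; apply: intertwinesF.
(* the class of the restriction to [H] normalises the image of [Phi] *)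
apply: (solvable_rel hR1 Aut_pair_subgroup _ solN).
  move=> f Af; have [a af] := Aut_pair_incl Af; have [b fb] := Aut_pair_proj Af.
  exists (to_out a); last by exists a.
  have PE q : Phi E (b q) ^ to_out a = Phi E q.
    by rewrite (Phi_intertwines _ af fb) /conjg !mulgA mulVg mul1g mulgVK.
  rewrite /normalizer /= eqEsubset; split=> [_ [_ [q _ <-] <-]|_ [q _ <-]].
    by exists (b^-1 q) => //; rewrite -PE autVK.
  by exists (Phi E (b q)) => //; exists (b q).
have sA1 := rel_hom_ker_subgroup hR1 Aut_pair_subgroup.
(* once that class is trivial, [b] preserves [Phi], hence its kernel *)
apply: (solvable_rel hR2 sA1 _ solK).
  move=> f [Af [a af a1]]; have [b fb] := Aut_pair_proj Af.
  have bK q : Phi E (b q) = Phi E q.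
    by rewrite (Phi_intertwines _ af fb) a1 mul1g divg1.
  have bVK q : Phi E (b^-1 q) = Phi E q by rewrite -bK autVK.
  have inK q : Phi E q = 1 -> exists k : hom_ker_group (Phi E), val k = q.
    move=> q1; have qK : q \in hom_ker (Phi E) by apply/mem_set.
    by exists (Sub q qK); rewrite SubK.
  have valK (k : hom_ker_group (Phi E)) : Phi E (val k) = 1.
    by have /set_mem := valP k.
  have [|k|k|k kb] := @aut_restrict (hom_ker_group (Phi E)) Q val b.
  - exact: val_inj.
  - by apply: inK; rewrite bK valK.
  - by apply: inK; rewrite bVK valK.
  by exists k => //; exists b.
have sA2 := rel_hom_ker_subgroup hR2 sA1.
(* [B] is the stability group of the chain formed by [ker Phi] and [Q] *)
pose B := [set b : group_aut Q | (forall q, Phi E q = 1 -> b q = q) /\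
                                 forall q, Phi E (b q / q) = 1].
apply: (@solvable_rel _ _ _ _ B hRp sA2).
- move=> f [[Af [a af a1]] [b fb kb]]; exists b => //; split=> q.
    move=> q1; have qK : q \in hom_ker (Phi E) by apply/mem_set.
    by have := kb (Sub q qK); rewrite !SubK.
  by rewrite PhiF (Phi_intertwines _ af fb) a1 mul1g divg1 mulgV.
- apply: solvable_commute => b b' [bK bQ] [bK' bQ'].
  apply: (@stabilizer_commute _ [set q | Phi E q = 1]) => //.
    split=> [|x y /= x1 y1]; first exact: gmulf1.
    by rewrite PhiF x1 y1 mulgV.
  by move=> x n /= n1; rewrite PhiF PhiM n1 mulg1 mulgV.
have sA3 := rel_hom_ker_subgroup hRp sA2.
(* the restriction to [H] is still inner, and is sent to an element inducing it *)
apply: (solvable_rel hR3 sA3 _ solH).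
  move=> f [[[Af [a af a1]] _] _].
  have /to_outP[h _] : to_out a = to_out 1 by rewrite a1 gmulf1.
  by rewrite divg1 => hE; exists h => //; rewrite /R3 hE.
apply: solvable_commute => f f' [[_ fp] fi] [[_ fp'] fi'].
have fix_incl (k : group_aut G) : R3 k 1 ->
    forall n, range (incl E) n -> k n = n.
  by move=> ki _ [h _ <-]; rewrite -ki gmulf1.
apply: (@stabilizer_commute _ (range (incl E))) => //.
- split=> [|_ _ [h _ <-] [h' _ <-]]; first by exists 1 => //; apply: gmulf1.
  by exists (h / h') => //; apply: gmulfF.
- by move=> x _ [h _ <-]; exists (ext_conj_fun E x h) => //; apply: ext_conj_funE.
- exact: fix_incl.
- exact: fix_incl.
- move=> x; have [|h <-] := @proj_eq1 (f x / x); last by exists h.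
  by rewrite gmulfF fp mulgV.
- move=> x; have [|h <-] := @proj_eq1 (f' x / x); last by exists h.
  by rewrite gmulfF fp' mulgV.
Qed.

End AutPairSolvable.

(** * Extensions with abelian middle group *)

Section AbelianExtensions.
Local Open Scope classical_set_scope.
Local Open Scope group_scope.

Definition abelian_type (G : groupType) : Prop := forall x y : G, commute x y.

Lemma solvable_aut_iso (X Y : groupType) (i : {hom X -> Y}) :
  injective i -> (forall y, exists x, i x = y) ->
  solvable_group (group_aut X) <-> solvable_group (group_aut Y).
Proof.
move=> iI iS; have i1 x : i x = 1 -> x = 1.
  by move=> ix; apply: iI; rewrite ix gmulf1.
split=> sol.
  apply: (@solvable_rel _ _ (fun g f => intertwines i f g) setT setT) => //.
  - split=> // g g' f f'; exact: intertwinesF.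
  - by move=> g _; have [|x|x|f fg] := @aut_restrict _ _ i g; last by exists f.
  apply: solvable_commute => g g' [_ ig] [_ ig']; apply: autP => y.
  by have [x <-] := iS y; rewrite !aut_mulE -ig' -ig -ig'.
apply: (@solvable_rel _ _ (intertwines i) setT setT) => //.
- split=> // f f' g g'; exact: intertwinesF.
- move=> f _; have [//|x /i1 ->|x /i1 ->|g fg] := @aut_quotient _ _ i f.
  + by rewrite aut1 gmulf1.
  + by rewrite aut1 gmulf1.
  by exists g.
apply: solvable_commute => f f' [_ fi] [_ fi']; apply: autP => x.
by apply: iI; rewrite !aut_mulE fi fi' !aut_oneE fi' fi.
Qed.

Variables (H G Q : groupType) (E : extension H G Q).
Hypothesis abG : abelian_type G.

Lemma ext_abelian_ker : abelian_type H.
Proof. by move=> x y; apply: (@incl_inj _ _ _ E); rewrite !gmulfM abG. Qed.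

Lemma Phi_abelian q : Phi E q = 1.
Proof.
have [g <-] := proj_surj E q; rewrite Phi_proj.
suff -> : ext_conj E g = 1 by apply: gmulf1.
apply: autP => h; apply: (@incl_inj _ _ _ E).
by rewrite /= ext_conj_funE abG mulKg.
Qed.

Lemma condition1_abelian : condition E 1.
Proof. by apply: solvable_commute => x y _ _; apply: ext_abelian_ker. Qed.

Lemma inner_abelian (x : H) : inner x = 1.
Proof.
by apply: autP => y /=; rewrite /inner_fun ext_abelian_ker mulKg.
Qed.

(** The image of [Phi] is trivial, so everything normalises it, and [H] has no inner
    automorphism, so [Aut H] is [Out H]. *)
Lemma condition3_abelian : condition E 3 <-> solvable_group (group_aut H).
Proof.
have PhiE : range (Phi E) = [set 1].
  rewrite eqEsubset; split=> [_ [q _ <-]|_ ->]; first exact: Phi_abelian.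
  by exists 1 => //; apply: Phi_abelian.
rewrite /condition PhiE; split=> sol.
  apply: (@solvable_embed _ _ (@to_out H) _ _ _ _ sol).
  - exact: to_out_mul.
  - move=> f g /to_outP[x _]; rewrite inner_abelian => fg.
    by apply/eqP; rewrite -divg_eq1 -fg.
  - move=> f; rewrite /normalizer /= eqEsubset; split=> [_ [_ -> <-]|_ ->].
      by rewrite /= conj1g.
    by exists 1 => //; rewrite conj1g.
apply: (@solvableS _ _ setT) => //.
apply: (@solvable_rel _ _ (fun o f => to_out f = o) setT setT) => //.
- split=> [|o o' f f' <- <-]; [exact: gmulf1 | exact: gmulfF].
- by move=> o _; exists (out_repr o) => //; apply: out_reprK.
by apply: solvable_commute => o o' [_ <-] [_ <-].
Qed.

(** The kernel of [Phi] is a copy of [Q]. *)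
Lemma condition4_abelian : condition E 4 <-> solvable_group (group_aut Q).
Proof.
have valM : {morph (val : hom_ker_group (Phi E) -> Q) : x y / x * y} by [].
apply: (@solvable_aut_iso _ _ (hom_of valM)) => [|q]; first exact: val_inj.
have qK : q \in hom_ker (Phi E) by apply/mem_set/Phi_abelian.
by exists (Sub q qK); apply: SubK.
Qed.

End AbelianExtensions.

Section PowerAutomorphisms.
Local Open Scope classical_set_scope.
Local Open Scope group_scope.

(** Holds for groups all of whose finitely generated subgroups are finite cyclic; such
    automorphisms commute because powers of an element do. *)
Definition power_auts (X : groupType) : Prop :=
  forall (f : group_aut X) x, exists n, f x = x ^+ n.

Lemma autX (X : groupType) (f : group_aut X) x n : f (x ^+ n) = f x ^+ n.
Proof. by elim: n => [|n IH]; rewrite ?aut1 // !expgS group_autM IH. Qed.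

Lemma power_auts_solvable (X : groupType) :
  power_auts X -> solvable_group (group_aut X).
Proof.
move=> pX; apply: solvable_commute => f g _ _; apply: autP => x.
rewrite !aut_mulE; have [m fx] := pX f x; have [n gx] := pX g x.
by rewrite gx fx !autX fx gx -!expgnA mulnC.
Qed.

(** The criterion by which the automorphism groups of [D * C] and [Z * C] are shown
    to be solvable. *)
Lemma solvable_aut_abelian_ext (H G Q : groupType) (E : extension H G Q) :
  abelian_type G -> is_characteristic (range (incl E)) ->
  solvable_group (group_aut H) -> solvable_group (group_aut Q) ->
  solvable_group (group_aut G).
Proof.
move=> abG chH sH sQ; apply: (@solvableS _ _ (Aut_pair E)) => [f _|].
  exact: chH.
apply: solvable_Aut_pair; first exact: condition1_abelian.
  exact/condition3_abelian.
exact/condition4_abelian.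
Qed.

End PowerAutomorphisms.

(** * The square of an abelian group of exponent 7 *)

Section PlaneAutomorphisms.
Local Open Scope classical_set_scope.
Local Open Scope group_scope.

Variable V : groupType.
Hypothesis abV : abelian_type V.
Hypothesis V7 : forall x : V, x ^+ 7 = 1.

(** Matrices modulo 7 act on the square of [V], with entries used as exponents.
    Natural numbers as entries let all matrix identities be settled by evaluation. *)
Record mat2 := Mat2 { m11 : nat; m12 : nat; m21 : nat; m22 : nat }.

Definition mat2_mul (m n : mat2) : mat2 :=
  Mat2 (m11 m * m11 n + m12 m * m21 n) (m11 m * m12 n + m12 m * m22 n)
       (m21 m * m11 n + m22 m * m21 n) (m21 m * m12 n + m22 m * m22 n).

Definition mat2_eq7 (m n : mat2) : bool :=
  [&& m11 m == m11 n %[mod 7], m12 m == m12 n %[mod 7],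
      m21 m == m21 n %[mod 7] & m22 m == m22 n %[mod 7]].

Definition mat2_fun (m : mat2) (v : V * V) : V * V :=
  (v.1 ^+ m11 m * v.2 ^+ m12 m, v.1 ^+ m21 m * v.2 ^+ m22 m).

Lemma expg_eq7 (x : V) m n : m == n %[mod 7] -> x ^+ m = x ^+ n.
Proof.
have expg_mod7 k : x ^+ k = x ^+ (k %% 7).
  by rewrite {1}(divn_eq k 7) mulnC expgnDr expgnA V7 expg1n mul1g.
by move=> /eqP mn; rewrite expg_mod7 mn -expg_mod7.
Qed.

Lemma abelian_mulgACA : @interchange V *%g *%g.
Proof. by move=> x y z t; rewrite -!mulgA; congr (_ * _); rewrite !mulgA (abV y). Qed.

Lemma mat2_fun_morph m : {morph mat2_fun m : v w / v * w}.
Proof.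
move=> [x y] [x' y']; rewrite /mat2_fun /= !expgMn; do ?exact: abV.
by congr (_, _); apply: abelian_mulgACA.
Qed.

Lemma mat2_fun_comp m n v : mat2_fun m (mat2_fun n v) = mat2_fun (mat2_mul m n) v.
Proof.
have rowE x y a b c d p q :
    (x ^+ a * y ^+ b) ^+ p * (x ^+ c * y ^+ d) ^+ q =
    x ^+ (p * a + q * c) * y ^+ (p * b + q * d) :> V.
  rewrite !expgMn; do ?exact: abV.
  by rewrite abelian_mulgACA -!expgnA !expgnDr !(mulnC p) !(mulnC q).
by congr (_, _); apply: rowE.
Qed.

Lemma mat2_fun_eq7 m n v : mat2_eq7 m n -> mat2_fun m v = mat2_fun n v.
Proof.
by case/and4P=> *; congr (_, _); congr (_ * _); apply: expg_eq7.
Qed.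

Definition mat2_inv (m n : mat2) : bool :=
  mat2_eq7 (mat2_mul n m) (Mat2 1 0 0 1).

Lemma mat2_funK m n : mat2_inv m n -> cancel (mat2_fun m) (mat2_fun n).
Proof.
move=> mn v; rewrite mat2_fun_comp (mat2_fun_eq7 _ mn) /mat2_fun.
by case: v => x y /=; rewrite !expg1 !expg0 mulg1 mul1g.
Qed.

Definition mat2_aut (m n : mat2) (mn : mat2_inv m n) (nm : mat2_inv n m) :
    group_aut (V * V)%type :=
  GroupAut (mat2_fun_morph m) (Bijective (mat2_funK mn) (mat2_funK nm)).

Definition upper : group_aut (V * V)%type :=
  @mat2_aut (Mat2 1 1 0 1) (Mat2 1 6 0 1) isT isT.
Definition lower : group_aut (V * V)%type :=
  @mat2_aut (Mat2 1 0 1 1) (Mat2 1 0 6 1) isT isT.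
Definition diag : group_aut (V * V)%type :=
  @mat2_aut (Mat2 2 0 0 4) (Mat2 4 0 0 2) isT isT.

(** In [SL_2(7)], the product [upper^i * lower^j * upper^k * lower^l] is
    [diag(2, 4)] as soon as [j * k = 3], [i * j = 1], [k = 3 * i] and [j = 3 * l];
    the exponents 1, 1, 3, 5 satisfy this. *)
Lemma diagE : diag = upper * (lower * (upper * (upper * (upper *
  (lower * (lower * (lower * (lower * lower)))))))).
Proof.
apply: autP => v; rewrite !aut_mulE /= !mat2_fun_comp.
exact: mat2_fun_eq7.
Qed.

Lemma commgE (G : groupType) (x y z : G) : x * y = y * x * z -> z = [~ x, y].
Proof. by rewrite /commg /conjg => ->; rewrite !mulgA mulgVK mulVg mul1g. Qed.

(** Conjugation by [diag(a, a^-1)] multiplies the transvection parameter by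
    [a^-2] (on [upper]) or [a^2] (on [lower]). With [a = 2], [a^-2 - 1 = 1] modulo 7,
    so the commutator with [upper] is [upper] itself; for [lower] one uses the
    inverse of [diag], which is its square. This is what makes 7 a convenient prime. *)
Lemma upper_commg : upper = [~ upper, diag].
Proof.
apply: commgE; apply: autP => v; rewrite !aut_mulE /= !mat2_fun_comp.
exact: mat2_fun_eq7.
Qed.

Lemma lower_commg : lower = [~ lower, diag * diag].
Proof.
apply: commgE; apply: autP => v; rewrite !aut_mulE /= !mat2_fun_comp.
exact: mat2_fun_eq7.
Qed.

(** The two transvections generate [diag], and are commutators of elements of the
    subgroup they generate; so they lie in every term of the derived series. *)
Lemma not_solvable_aut_square (x0 : V) :
  x0 != 1 -> ~ solvable_group (group_aut (V * V)%type).
Proof.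
move=> x0N1 /is_solvableP[n Dn].
have [/Dn u1 _] : iter n (@derived_subgroup _) setT upper /\
                  iter n (@derived_subgroup _) setT lower.
  elim: n {Dn} => [//|n [Du Dl]]; set D := iter n _ _ in Du Dl *.
  have sD : is_subgroup D by apply: iter_derived_is_subgroup.
  have Dd : D diag by rewrite diagE; do !apply: (subgroupM sD) => //.
  rewrite iterS -/D upper_commg lower_commg.
  split; apply: derived_commg => //; exact: subgroupM.
have /(congr1 fst) /= := congr1 (fun f : group_aut (V * V)%type => f (1, x0)) u1.
by rewrite expg1n mul1g => /eqP; rewrite (negPf x0N1).
Qed.

End PlaneAutomorphisms.

(** * Automorphisms of the automorphism group of a simple group *)

Section SimpleGroups.
Local Open Scope classical_set_scope.
Local Open Scope group_scope.

Lemma inner1 (G : groupType) : inner (1 : G) = 1.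
Proof. exact: gmulf1. Qed.

Lemma innerF (G : groupType) (x y : G) : inner (x / y) = inner x / inner y.
Proof. exact: gmulfF. Qed.

Definition is_normal (G : groupType) (N : set G) : Prop :=
  is_subgroup N /\ forall x y, N x -> N (inner y x).

Definition simple_type (S : groupType) : Prop :=
  ~ abelian_type S /\
  forall N : set S, is_normal N -> N `<=` [set 1] \/ N = [set: S].

Variable S : groupType.
Hypothesis simS : simple_type S.

Lemma simple_center (x : S) : (forall y, commute x y) -> x = 1.
Proof.
pose Z := [set x : S | forall y, commute x y].
have nZ : is_normal Z.
  split; first split=> [y|a b Za Zb y]; first exact/commute_sym/commute1.
    by apply/commute_sym/commuteM; [|apply/commuteV]; apply/commute_sym.
  move=> a b Za; suff -> : inner b a = a by [].
  by rewrite /= /inner_fun -Za mulgK.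
case: (simS.2 _ nZ) => [Z1 /Z1 //|ZT].
by case: simS.1 => a b; have : Z a by rewrite ZT.
Qed.

Lemma simple_not_solvable : ~ solvable_group S.
Proof.
have DT : derived_subgroup [set: S] = [set: S].
  have [||//] := simS.2 (derived_subgroup [set: S]).
    split=> [|x y Dx]; first exact: generated_is_subgroup.
    have [||z Dz ->//] :=
      @rel_hom_iter_derived _ _ (fun x z => inner y x = z) setT setT 1 _ _ x Dx.
    - split=> [|a a' _ _ <- <-]; [exact: aut1 | exact: autF].
    - by move=> z _; exists (inner y z).
  move=> D1; case: simS.1 => x y; apply/commgP/eqP/D1.
  exact: derived_commg.
move=> /is_solvableP[n]; have -> : iter n (@derived_subgroup S) setT = setT.
  by elim: n => //= n ->.
by move=> S1; case: simS.1 => x y; rewrite (S1 x) // (S1 y).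
Qed.

Lemma inner_inj : injective (@inner S).
Proof.
move=> x y xy; apply/eqP; rewrite -divg_eq1; apply/eqP/simple_center => z.
have := congr1 (fun f : group_aut S => f (y^-1 * z * y)) xy.
rewrite /= /inner_fun !mulgA mulgV mul1g mulgK => e.
by rewrite /commute mulgA -[in RHS]e mulgVK mulgK.
Qed.

Local Notation A := (group_aut S).

(** The reason why [Aut S] is determined by its action on [Inn S]. *)
Lemma centralizes_Inn (f : A) : (forall x, commute f (inner x)) -> f = 1.
Proof.
move=> fC; apply: autP => x; apply: inner_inj.
by rewrite -innerJ fC mulgK.
Qed.

(** The [x] for which [phi (inner x)] is inner form a normal subgroup [J]. If [J] were
    trivial, [phi (Inn S)] and [Inn S] would be normal subgroups of [Aut S] with
    trivial intersection, hence would commute; but only 1 centralises [Inn S]. *)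
Lemma aut_Aut_Inn (phi : group_aut A) x : exists y, phi (inner x) = inner y.
Proof.
pose J := [set x : S | exists y, phi (inner x) = inner y].
have nJ : is_normal J.
  split; first split; first by exists 1; rewrite !inner1 aut1.
    by move=> a b [c ac] [d bd]; exists (c / d); rewrite !innerF autF ac bd.
  move=> a b [c ac]; exists (phi (inner b) c).
  by rewrite -innerJ autF group_autM ac innerJ.
case: (simS.2 _ nJ) => [J1|JT]; last by have : J x by rewrite JT.
case: (simple_not_solvable); apply: solvable_commute => a b _ _.
suff all1 (c : S) : c = 1 by rewrite (all1 a) (all1 b).
suff : inner c = 1 by rewrite -(inner1 S) => /inner_inj.
apply: (@aut_inj _ phi); rewrite aut1; apply: centralizes_Inn => d.
have [e eE] : exists e, phi e = inner d by exists (phi^-1 (inner d)); rewrite autVK.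
have J1c : c / e c = 1.
  apply: J1; exists (phi (inner c) d / d).
  by rewrite !innerF -!innerJ !autF !group_autM eE invgF invgM !mulgA.
have ec : e c = c by apply/esym/eqP; rewrite -divg_eq1; apply/eqP.
rewrite -eE /commute -!group_autM; congr (phi _).
by rewrite -{1}ec -innerJ mulgVK.
Qed.

(** By the previous lemma [phi] acts on [Inn S], that is on [S], as some [a]. Then
    [phi f] and the conjugate of [f] by [a] act in the same way on [Inn S], for every
    [f], so they are equal. *)
Lemma aut_Aut_inner (phi : group_aut A) : exists a, phi = inner a.
Proof.
have [a0 aE] := choice (aut_Aut_Inn phi).
have [b0 bE] := choice (aut_Aut_Inn phi^-1).
have aM : {morph a0 : x y / x * y}.
  by move=> x y; apply: inner_inj; rewrite -aE !innerM group_autM !aE.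
have ab : cancel a0 b0 by move=> x; apply: inner_inj; rewrite -bE -aE autK.
have ba : cancel b0 a0 by move=> x; apply: inner_inj; rewrite -aE -bE autVK.
pose a := GroupAut aM (Bijective ab ba).
exists a; apply: autP => f; apply: (canRL (mulgK _)); apply: autP => x.
by apply: inner_inj; rewrite !aut_mulE /= -innerJ -!aE -group_autM -autF innerJ.
Qed.

End SimpleGroups.

Section SimpleAlternating.
(* imported locally, as quotients of finite groups share the notation of division *)
Import all_fingroup all_solvable.
Local Open Scope group_scope.

Lemma simple_type_fin (gT : finGroupType) :
  simple [set: gT] -> ~~ abelian [set: gT] -> simple_type gT.
Proof.
move=> /simpleP[_ simG] nab; split.
  by move=> cG; case/negP: nab; apply/centsP => x _ y _; apply: cG.
move=> N [[N1 NF] nN].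
have gN : group_set [set x | `[< N x >]]%SET.
  apply/group_setP; split=> [|x y]; rewrite !inE; first exact/asboolP.
  by move=> /asboolP Nx /asboolP Ny; apply/asboolP; apply: subgroupM.
have Nn : (Group gN <| [set: gT])%g.
  apply/normalP; split=> [|y _]; first exact: finset.subsetT.
  apply/setP => x; rewrite mem_conjg !inE; apply/asboolP/asboolP => Nx.
    have := nN _ y^-1 Nx.
    by rewrite /= /inner_fun conjgE !invgK !mulgA mulVg mul1g mulgVK.
  by rewrite conjgE invgK mulgA; apply: nN.
case: (simG _ Nn) => /= /setP NE; [left=> x Nx|right].
  by have := NE x; rewrite !inE asboolT // => /esym/eqP.
by apply/seteqP; split=> // x _; have := NE x; rewrite !inE => /asboolP.
Qed.

Lemma exists_simple_type : exists S : groupType, simple_type S.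
Proof.
exists [subg 'Alt_('I_5)]%type.
have o5 : 4 < #|'I_5| by rewrite card_ord.
apply: simple_type_fin; first by rewrite -(isog_simple (isog_subg _)) simple_Alt5.
rewrite -(isog_abelian (isog_subg _)); apply/negP => /abelian_sol.
by rewrite solvable_AltF.
Qed.

End SimpleAlternating.

(** * Extensions with a trivial end *)

Section Examples.
Local Open Scope classical_set_scope.
Local Open Scope group_scope.

Lemma exists_extension (H G Q : groupType) (i : H -> G) (p : G -> Q) :
  {morph i : x y / x * y} -> {morph p : x y / x * y} -> injective i ->
  (forall q, exists g, p g = q) -> (forall h, p (i h) = 1) ->
  (forall g, p g = 1 -> exists h, i h = g) ->
  exists E : extension H G Q, incl E =1 i.
Proof.
move=> iM pM iI pS pi kp.
have ex : range (hom_of iM) = hom_ker (hom_of pM).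
  by apply/seteqP; split=> [_ [h _ <-]|g /kp[h <-]]; [apply: pi | exists h].
by exists (@Extension _ _ _ (hom_of iM) (hom_of pM) iI pS ex).
Qed.

Lemma I1_eq1 (x : 'I_1) : x = 1.
Proof. by rewrite [x]ord1 [1]ord1. Qed.

Lemma exists_extension_triv_quotient (G : groupType) :
  exists E : extension G G 'I_1, incl E =1 id.
Proof.
apply: (@exists_extension _ _ _ id (fun=> 1)) => //.
- by move=> x y; rewrite mulg1.
- by move=> q; exists 1; rewrite (I1_eq1 q).
- by move=> g _; exists g.
Qed.

Lemma exists_extension_triv_ker (G : groupType) :
  exists E : extension 'I_1 G G, incl E =1 (fun=> 1).
Proof.
apply: (@exists_extension _ _ _ (fun=> 1) id) => //.
- by move=> x y; rewrite mulg1.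
- by move=> x y _; rewrite (I1_eq1 x) (I1_eq1 y).
- by move=> q; exists q.
- by move=> g ->; exists 1.
Qed.

Lemma characteristic_triv_quotient (G : groupType) (E : extension G G 'I_1) :
  is_characteristic (range (incl E)).
Proof.
have incl_all g : range (incl E) g.
  by have [h <-] := proj_eq1 (I1_eq1 (proj E g)); exists h.
move=> f; apply/seteqP; split=> g _; first exact: incl_all.
by exists (f^-1 g); [apply: incl_all | apply: autVK].
Qed.

Lemma characteristic_triv_ker (G : groupType) (E : extension 'I_1 G G) :
  is_characteristic (range (incl E)).
Proof.
have incl1 : range (incl E) = [set 1].
  apply/seteqP; split=> [_ [h _ <-]|_ ->].
    by rewrite (I1_eq1 h) /= gmulf1.
  by exists 1 => //; apply: gmulf1.
move=> f; rewrite incl1; apply/seteqP.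
by split=> [_ [_ -> <-]|_ ->]; rewrite /= ?aut1 //; exists 1; rewrite ?aut1.
Qed.

Lemma solvable_aut_trivial : solvable_group (group_aut 'I_1).
Proof.
apply: solvable_commute => f g _ _; apply: autP => x.
by rewrite (I1_eq1 ((f * g) x)) (I1_eq1 ((g * f) x)).
Qed.

(** The extension is [Aut S -> Aut S -> 1] with [S] simple and nonabelian. The
    composite of [S -> Aut S -> Aut (Aut S)] is injective. *)
Lemma nonsolvable_aut_without_solvable_ker :
  exists (H G Q : groupType) (E : extension H G Q),
    (forall k : nat, 1 <= k <= 4 -> k <> 1%N -> condition E k) /\
    ~ solvable_group (group_aut G).
Proof.
have [S simS] := exists_simple_type; pose A := group_aut S.
have [E _] := exists_extension_triv_quotient A.
exists A, A, 'I_1, E; split; last first.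
  apply: contra_not (simple_not_solvable simS) => solA.
  apply: (@solvable_embed _ _ (fun x => inner (inner x)) _ _ _ _ solA) => //.
    by move=> x y; rewrite !innerM.
  move=> x y /(congr1 (fun f : group_aut A => f (inner _))) xy.
  apply: (inner_inj simS); apply: autP => z; apply: (inner_inj simS).
  by rewrite -!innerJ; apply: xy.
move=> [|[|[|[|[|//]]]]] // _ _.
- exact: characteristic_triv_quotient.
- apply: solvable_commute => o o' _ _; suff o1 (x : group_out A) : x = 1.
    by rewrite (o1 o) (o1 o').
  rewrite -[x]out_reprK; have [a ->] := aut_Aut_inner simS (out_repr x).
  by apply/to_outP; exists a; rewrite // divg1.
- apply: solvable_commute => f g _ _; apply: autP => x; apply: val_inj.
  by rewrite (I1_eq1 (val ((f * g) x))) (I1_eq1 (val _)).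
Qed.

End Examples.

(** * Automorphisms of the integers, of a cyclic group and of the roots of unity *)

Section AdditiveGroups.
Local Open Scope classical_set_scope.
Local Open Scope ring_scope.
Import GRing.Theory Num.Theory.

Local Notation mulg_of := Algebra.to_multiplicative.

Lemma abelian_additive (V : zmodType) : abelian_type (mulg_of V).
Proof. exact: addrC. Qed.

(** An additive endomorphism of a ring generated by 1 is the multiplication by the
    image of 1. *)
Lemma solvable_aut_additive (R : comNzRingType) :
  (forall x : R, exists n : int, x = n%:~R) ->
  solvable_group (group_aut (mulg_of R)).
Proof.
move=> genR.
have fD (f : group_aut (mulg_of R)) (x y : R) : f (x + y) = f x + f y :> R.
  exact: (group_autM f x y).
have fE (f : group_aut (mulg_of R)) (x : R) : f x = x * f 1 :> R.
  have f0 : f 0 = 0 :> R := aut1 f.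
  have fn n : f n%:R = n%:R * f 1 :> R.
    by elim: n => [|n IH]; rewrite ?mul0r // -natr1 fD IH mulrDl mul1r.
  have [[n|n] ->] := genR x; first exact: fn.
  rewrite NegzE mulrNz mulNr -[_%:~R * _]fn.
  by apply: (autV f).
apply: solvable_commute => f g _ _; apply: autP => x.
by rewrite !aut_mulE (fE f (g x)) (fE g x) (fE g (f x)) (fE f x) mulrAC.
Qed.

Lemma solvable_aut_int : solvable_group (group_aut (mulg_of int)).
Proof. by apply: solvable_aut_additive => x; exists x; rewrite intz. Qed.

Lemma solvable_aut_F7 : solvable_group (group_aut (mulg_of 'F_7)).
Proof.
by apply: solvable_aut_additive => x; exists (val x)%:Z; rewrite -[LHS]natr_Zp.
Qed.

Lemma F7_exponent (x : mulg_of 'F_7) : (x ^+ 7 = 1)%g.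
Proof.
have : (x : 'F_7) *+ 7 = 0 by rewrite -mulr_natr pchar_Zp ?mulr0.
by [].
Qed.

End AdditiveGroups.

Section RootsOfUnity.
Import GRing.Theory Num.Theory.
Local Open Scope ring_scope.

Definition is_unity (x : algC) : bool := `[< exists n, x ^+ n.+1 = 1 >].

Definition unity_group : Type := {x : algC | is_unity x}.

HB.instance Definition _ := SubChoice.on unity_group.

Lemma is_unity1 : is_unity 1.
Proof. by apply/asboolP; exists 0; rewrite expr1. Qed.

Lemma is_unityM x y : is_unity x -> is_unity y -> is_unity (x * y).
Proof.
move=> /asboolP[m xm] /asboolP[n yn]; apply/asboolP; exists (m.+1 * n.+1).-1%N.
by rewrite prednK ?muln_gt0 // exprMn {1}exprM mulnC exprM xm yn !expr1n mulr1.
Qed.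

Lemma is_unityV x : is_unity x -> is_unity x^-1.
Proof.
by move=> /asboolP[m xm]; apply/asboolP; exists m; rewrite exprVn xm invr1.
Qed.

Definition unity_mul (x y : unity_group) : unity_group :=
  exist _ (val x * val y) (is_unityM (valP x) (valP y)).
Definition unity_one : unity_group := exist _ 1 is_unity1.
Definition unity_inv (x : unity_group) : unity_group :=
  exist _ (val x)^-1 (is_unityV (valP x)).

Lemma unity_neq0 (x : unity_group) : val x != 0.
Proof.
have /asboolP[n xn] := valP x; apply: contra_eq_neq xn => ->.
by rewrite expr0n eq_sym oner_eq0.
Qed.

Lemma unity_mulA : associative unity_mul.
Proof. by move=> x y z; apply: val_inj; apply: mulrA. Qed.
Lemma unity_mul1g : left_id unity_one unity_mul.
Proof. by move=> x; apply: val_inj; apply: mul1r. Qed.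
Lemma unity_mulg1 : right_id unity_one unity_mul.
Proof. by move=> x; apply: val_inj; apply: mulr1. Qed.
Lemma unity_mulVg : left_inverse unity_one unity_inv unity_mul.
Proof. by move=> x; apply: val_inj; apply: mulVf; apply: unity_neq0. Qed.
Lemma unity_mulgV : right_inverse unity_one unity_inv unity_mul.
Proof. by move=> x; apply: val_inj; apply: mulfV; apply: unity_neq0. Qed.

HB.instance Definition _ :=
  isGroup.Build unity_group unity_mulA unity_mul1g unity_mulg1 unity_mulVg
    unity_mulgV.

Lemma abelian_unity : abelian_type unity_group.
Proof. by move=> x y; apply: val_inj; apply: mulrC. Qed.

Lemma val_unityX (x : unity_group) n : val (x ^+ n)%g = val x ^+ n.
Proof. by elim: n => [//|n IH]; rewrite expgS exprS -IH. Qed.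

Lemma unity_root (x : algC) n : (0 < n)%N -> x ^+ n = 1 ->
  exists2 y : unity_group, val y = x & (y ^+ n = 1)%g.
Proof.
case: n => // n _ xn; have ux : is_unity x by apply/asboolP; exists n.
by exists (exist _ x ux) => //; apply: val_inj; rewrite val_unityX.
Qed.

Lemma unity_divisible n (x : unity_group) : (0 < n)%N ->
  exists y : unity_group, (y ^+ n = x)%g.
Proof.
move=> n0; have /asboolP[m xm] := valP x; pose y := n.-root (val x).
have yn : y ^+ n = val x by apply: rootCK.
have [||z zy _] := @unity_root y (n * m.+1); first by rewrite muln_gt0 n0.
  by rewrite exprM yn.
by exists z; apply: val_inj; rewrite val_unityX zy.
Qed.

Lemma unity_torsion n : (0 < n)%N ->
  exists z : unity_group, n.-primitive_root (val z) /\
    forall x : unity_group, (x ^+ n = 1)%g -> exists i, (x = z ^+ i)%g.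
Proof.
move=> n0; have [z0 zP] := C_prim_root_exists n0.
have [z zE _] := unity_root n0 (prim_expr_order zP).
exists z; rewrite zE; split=> // x /(congr1 val); rewrite val_unityX => xn.
have [i xE] := prim_rootP zP xn.
by exists i; apply: val_inj; rewrite val_unityX zE.
Qed.

(** The elements killed by [n] form a finite cyclic group, generated by a primitive
    root, which every automorphism preserves. *)
Lemma power_auts_unity : power_auts unity_group.
Proof.
move=> f x; have /asboolP[n xn] := valP x.
have {}xn : (x ^+ n.+1 = 1)%g by apply: val_inj; rewrite val_unityX.
have [z [zP zG]] := @unity_torsion n.+1 isT.
have zn : (z ^+ n.+1 = 1)%g.
  by apply: val_inj; rewrite val_unityX prim_expr_order.
have [i ->] := zG _ xn; have [|j fz] := zG (f z); first by rewrite -autX zn aut1.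
by exists j; rewrite autX fz expgnAC.
Qed.

End RootsOfUnity.

(** * The abelian examples *)

Section AbelianExamples.
Import GRing.Theory Num.Theory.
Local Open Scope classical_set_scope.
Local Open Scope group_scope.

Local Notation C := (Algebra.to_multiplicative 'F_7).
Local Notation Z := (Algebra.to_multiplicative int).
Local Notation D := unity_group.

Lemma abelian_prod (X Y : groupType) :
  abelian_type X -> abelian_type Y -> abelian_type (X * Y)%type.
Proof. by move=> cX cY [x y] [x' y']; congr (_, _); [apply: cX | apply: cY]. Qed.

Lemma expg_pair (X Y : groupType) (x : X) (y : Y) n :
  (x, y) ^+ n = (x ^+ n, y ^+ n).
Proof. by elim: n => [//|n IH]; rewrite !expgS IH. Qed.

Lemma characteristic_torsion (G : groupType) n :
  is_characteristic [set g : G | g ^+ n = 1].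
Proof.
move=> f; apply/seteqP; split=> [_ [g gn <-]|g gn] /=.
  by rewrite -autX gn aut1.
exists (f^-1 g); last exact: autVK.
by rewrite /= -(autX f^-1) gn (aut1 f^-1).
Qed.

Lemma characteristic_powers (G : groupType) n :
  is_characteristic (range (fun g : G => g ^+ n)).
Proof.
move=> f; apply/seteqP; split=> [_ [_ [g _ <-] <-]|_ [g _ <-]] /=.
  by exists (f g); rewrite ?autX.
by exists ((f^-1 g) ^+ n); [exists (f^-1 g) | rewrite autX autVK].
Qed.

Lemma exists_inl_extension (X Y : groupType) :
  exists E : extension X (X * Y)%type Y, incl E =1 (fun x => (x, 1)).
Proof.
apply: (@exists_extension _ _ _ (fun x => (x, 1)) snd) => //.
- by move=> x y; congr (_, _); rewrite mulg1.
- by move=> x y [].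
- by move=> y; exists (1, y).
- by move=> [x y] /= ->; exists x.
Qed.

Lemma exists_inr_extension (X Y : groupType) :
  exists E : extension Y (X * Y)%type X, incl E =1 (fun y => (1, y)).
Proof.
apply: (@exists_extension _ _ _ (fun y => (1, y)) fst) => //.
- by move=> x y; congr (_, _); rewrite mulg1.
- by move=> x y [].
- by move=> x; exists (x, 1).
- by move=> [x y] /= ->; exists y.
Qed.

Lemma abelian_CC : abelian_type (C * C)%type.
Proof. by apply: abelian_prod; apply: abelian_additive. Qed.

Lemma not_solvable_aut_CC : ~ solvable_group (group_aut (C * C)%type).
Proof.
by apply: (@not_solvable_aut_square C _ F7_exponent (1 : 'F_7)%R) => //;
  apply: abelian_additive.
Qed.

Lemma abelian_DC : abelian_type (D * C)%type.
Proof. by apply: abelian_prod; [apply: abelian_unity | apply: abelian_additive]. Qed.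

Lemma abelian_ZC : abelian_type (Z * C)%type.
Proof. by apply: abelian_prod; apply: abelian_additive. Qed.

Lemma solvable_aut_unity : solvable_group (group_aut D).
Proof. exact/power_auts_solvable/power_auts_unity. Qed.

Lemma solvable_aut_DC : solvable_group (group_aut (D * C)%type).
Proof.
have [E inclE] := exists_inl_extension D C.
apply: (solvable_aut_abelian_ext (E := E)).
- exact: abelian_DC.
- suff -> : range (incl E) = range (fun g => g ^+ 7) by apply: characteristic_powers.
  apply/seteqP; split=> [_ [x _ <-]|_ [[x c] _ <-]]; rewrite /= ?inclE.
    have [y <-] := @unity_divisible 7 x isT.
    by exists (y, 1) => //; rewrite expg_pair expg1n.
  by exists (x ^+ 7) => //; rewrite inclE expg_pair F7_exponent.
- exact: solvable_aut_unity.
- exact: solvable_aut_F7.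
Qed.

Lemma int_expg7 (n : int) : (n : Z) ^+ 7 = (n * 7)%R.
Proof. by rewrite mulr_natr. Qed.

Lemma solvable_aut_ZC : solvable_group (group_aut (Z * C)%type).
Proof.
have [E inclE] := exists_inr_extension Z C.
apply: (solvable_aut_abelian_ext (E := E)).
- exact: abelian_ZC.
- suff -> : range (incl E) = [set g | g ^+ 7 = 1] by apply: characteristic_torsion.
  apply/seteqP; split=> [_ [c _ <-]|[n c]] /=.
    by rewrite inclE expg_pair expg1n F7_exponent.
  rewrite expg_pair => -[n7 _]; exists c => //; rewrite inclE; congr (_, _).
  move: n7; rewrite int_expg7 => /eqP; rewrite mulf_eq0 orbF => /eqP ->.
  by [].
- exact: solvable_aut_F7.
- exact: solvable_aut_int.
Qed.

Lemma exists_seventh_root :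
  exists i : C -> D, [/\ {morph i : x y / x * y}, injective i,
    forall x, i x ^+ 7 = 1 & forall y, y ^+ 7 = 1 -> exists x, i x = y].
Proof.
have [z [zP zG]] := @unity_torsion 7 isT.
have z7 : z ^+ 7 = 1 by apply: val_inj; rewrite val_unityX prim_expr_order.
have zmod n : z ^+ (n %% 7) = z ^+ n.
  by rewrite {2}(divn_eq n 7) mulnC expgnDr expgnA z7 expg1n mul1g.
exists (fun x : 'F_7 => z ^+ (x : nat)); split.
- by move=> x y; rewrite -expgnDr -[RHS]zmod.
- move=> x y /(congr1 val); rewrite !val_unityX => /eqP.
  rewrite (eq_prim_root_expr zP) => xy; apply/val_inj/eqP.
  by have := ltn_ord (y : 'F_7); have := ltn_ord (x : 'F_7) => /= lx ly;
    rewrite !modn_small in xy.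
- by move=> x; rewrite expgnAC z7 expg1n.
- move=> y /zG[n ->]; exists (inZp n : 'F_7); exact: zmod.
Qed.

Lemma nonsolvable_aut_without_characteristic :
  exists (H G Q : groupType) (E : extension H G Q),
    (forall k : nat, 1 <= k <= 4 -> k <> 2 -> condition E k) /\
    ~ solvable_group (group_aut G).
Proof.
have [E _] := exists_inl_extension C C.
exists C, (C * C)%type, C, E; split; last exact: not_solvable_aut_CC.
move=> [|[|[|[|[|//]]]]] // _ _.
- exact: (condition1_abelian E abelian_CC).
- exact/(condition3_abelian E abelian_CC)/solvable_aut_F7.
- exact/(condition4_abelian E abelian_CC)/solvable_aut_F7.
Qed.

Lemma nonsolvable_aut_without_solvable_normalizer :
  exists (H G Q : groupType) (E : extension H G Q),
    (forall k : nat, 1 <= k <= 4 -> k <> 3 -> condition E k) /\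
    ~ solvable_group (group_aut G).
Proof.
have [E _] := exists_extension_triv_quotient (C * C)%type.
exists (C * C)%type, (C * C)%type, 'I_1, E; split; last exact: not_solvable_aut_CC.
move=> [|[|[|[|[|//]]]]] // _ _.
- exact: (condition1_abelian E abelian_CC).
- exact: characteristic_triv_quotient.
- exact/(condition4_abelian E abelian_CC)/solvable_aut_trivial.
Qed.

Lemma nonsolvable_aut_without_solvable_aut_ker_Phi :
  exists (H G Q : groupType) (E : extension H G Q),
    (forall k : nat, 1 <= k <= 4 -> k <> 4 -> condition E k) /\
    ~ solvable_group (group_aut G).
Proof.
have [E _] := exists_extension_triv_ker (C * C)%type.
exists 'I_1, (C * C)%type, (C * C)%type, E; split; last exact: not_solvable_aut_CC.
move=> [|[|[|[|[|//]]]]] // _ _.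
- exact: (condition1_abelian E abelian_CC).
- exact: characteristic_triv_ker.
- exact/(condition3_abelian E abelian_CC)/solvable_aut_trivial.
Qed.

(** The second factor is moved by the automorphism [(x, c) |-> (x * i c, c)], where
    [i] embeds [C] in [D]. *)
Lemma solvable_aut_without_characteristic :
  exists (H G Q : groupType) (E : extension H G Q),
    [/\ ~ condition E 2,
        forall k : nat, 1 <= k <= 4 -> k <> 2 -> condition E k
      & solvable_group (group_aut G)].
Proof.
have [E inclE] := exists_inr_extension D C.
exists C, (D * C)%type, D, E; split; last exact: solvable_aut_DC.
  have [i [iM iI _ _]] := exists_seventh_root.
  pose f (g : D * C) : D * C := (g.1 * i g.2, g.2).
  pose f' (g : D * C) : D * C := (g.1 / i g.2, g.2).
  have fM : {morph f : x y / x * y}.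
    move=> [x c] [y d]; congr (_, _); rewrite /= iM.
    exact: (abelian_mulgACA abelian_unity).
  have ff' : cancel f f' by move=> [x c]; rewrite /f' /f /= mulgK.
  have f'f : cancel f' f by move=> [x c]; rewrite /f' /f /= mulgVK.
  move=> /(_ (GroupAut fM (Bijective ff' f'f))) /= chE.
  have : range (incl E) (f (1, 1%R)).
    by rewrite -chE; exists (1, 1%R) => //; exists 1%R => //; rewrite inclE.
  move=> [c _]; rewrite inclE /f /= mul1g => -[i1 _].
  have i0 : i 1 = 1 := (hom_morphism iM).1.
  by have := iI _ _ (etrans i0 i1).
move=> [|[|[|[|[|//]]]]] // _ _.
- exact: (condition1_abelian E abelian_DC).
- exact/(condition3_abelian E abelian_DC)/solvable_aut_F7.
- exact/(condition4_abelian E abelian_DC)/solvable_aut_unity.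
Qed.

(** The subgroup killed by 7 in [D * C] is a copy of [C * C], and few of its
    automorphisms extend: those of [D * C] preserve the seventh powers. The quotient
    by it is [D], as [D] is divisible. *)
Lemma solvable_aut_without_solvable_normalizer :
  exists (H G Q : groupType) (E : extension H G Q),
    [/\ ~ condition E 3,
        forall k : nat, 1 <= k <= 4 -> k <> 3 -> condition E k
      & solvable_group (group_aut G)].
Proof.
have [i [iM iI i7 iS]] := exists_seventh_root.
have [||||||E inclE] := @exists_extension (C * C)%type (D * C)%type D
    (fun p => (i p.1, p.2)) (fun p => p.1 ^+ 7).
- by move=> [a b] [c d]; congr (_, _); rewrite /= iM.
- by move=> [a b] [c d]; rewrite /= expgMn //; apply: abelian_unity.
- by move=> [a b] [c d] [/iI -> ->].
- by move=> x; have [y <-] := @unity_divisible 7 x isT; exists (y, 1).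
- by move=> [a b] /=.
- by move=> [x c] /= /iS[a <-]; exists (a, c).
exists (C * C)%type, (D * C)%type, D, E; split; last exact: solvable_aut_DC.
  by move=> /(condition3_abelian E abelian_DC)/not_solvable_aut_CC.
move=> [|[|[|[|[|//]]]]] // _ _.
- exact: (condition1_abelian E abelian_DC).
- rewrite /condition.
  suff -> : range (incl E) = [set g | g ^+ 7 = 1] by apply: characteristic_torsion.
  apply/seteqP; split=> [_ [[a b] _ <-]|[x c]] /=.
    by rewrite inclE expg_pair i7 F7_exponent.
  by rewrite expg_pair => /(congr1 fst)/iS[a <-]; exists (a, c).
- exact/(condition4_abelian E abelian_DC)/solvable_aut_unity.
Qed.

(** The quotient of [Z * C] by its seventh powers is a copy of [C * C], few of whose
    automorphisms lift: those of [Z * C] preserve the torsion. *)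
Lemma solvable_aut_without_solvable_aut_ker_Phi :
  exists (H G Q : groupType) (E : extension H G Q),
    [/\ ~ condition E 4,
        forall k : nat, 1 <= k <= 4 -> k <> 4 -> condition E k
      & solvable_group (group_aut G)].
Proof.
have [||||||E inclE] := @exists_extension Z (Z * C)%type (C * C)%type
    (fun n : int => ((n * 7)%R, 1)) (fun p => ((p.1 : int)%:~R%R, p.2)).
- by move=> m n; congr (_, _); [apply: mulrDl | rewrite mulg1].
- by move=> [m a] [n b]; congr (_, _); apply: intrD.
- by move=> m n [] /mulIf; apply.
- move=> [a b]; exists (Posz (a : 'F_7), b); congr (_, _).
  exact: (natr_Zp (a : 'F_7)).
- move=> n; congr (_, _); apply/eqP.
  by rewrite -(dvdz_pcharf (pchar_Fp (isT : prime 7))) dvdz_mull.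
- move=> [n c] [] /eqP; rewrite -(dvdz_pcharf (pchar_Fp (isT : prime 7))).
  by move=> /dvdzP[m ->] ->; exists m.
exists Z, (Z * C)%type, (C * C)%type, E; split; last exact: solvable_aut_ZC.
  by move=> /(condition4_abelian E abelian_ZC)/not_solvable_aut_CC.
move=> [|[|[|[|[|//]]]]] // _ _.
- exact: (condition1_abelian E abelian_ZC).
- rewrite /condition.
  suff -> : range (incl E) = range (fun g => g ^+ 7) by apply: characteristic_powers.
  apply/seteqP; split=> [_ [n _ <-]|_ [[n c] _ <-]]; rewrite /= ?inclE.
    by exists (n, 1) => //; rewrite expg_pair int_expg7 expg1n.
  by exists n => //; rewrite inclE expg_pair int_expg7 F7_exponent.
- exact/(condition3_abelian E abelian_ZC)/solvable_aut_int.
Qed.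

End AbelianExamples.

Theorem theorem7p2 :
  [/\ forall (H G Q : groupType) (E : extension H G Q),
        condition E 1 -> condition E 2 -> condition E 3 -> condition E 4 ->
        is_solvable (Aut_pair E),
      forall j : nat, 1 <= j <= 4 ->
        exists (H G Q : groupType) (E : extension H G Q),
          (forall k : nat, 1 <= k <= 4 -> k <> j -> condition E k) /\
          ~ solvable_group (group_aut G)
    & forall j : nat, 2 <= j <= 4 ->
        exists (H G Q : groupType) (E : extension H G Q),
          [/\ ~ condition E j,
              forall k : nat, 1 <= k <= 4 -> k <> j -> condition E k
            & solvable_group (group_aut G)] ].
Proof.
split.
- by move=> H G Q E c1 _ c3 c4; apply: solvable_Aut_pair.
- move=> [|[|[|[|[|//]]]]] // _.
  + exact: nonsolvable_aut_without_solvable_ker.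
  + exact: nonsolvable_aut_without_characteristic.
  + exact: nonsolvable_aut_without_solvable_normalizer.
  + exact: nonsolvable_aut_without_solvable_aut_ker_Phi.
- move=> [|[|[|[|[|//]]]]] // _.
  + exact: solvable_aut_without_characteristic.
  + exact: solvable_aut_without_solvable_normalizer.
  + exact: solvable_aut_without_solvable_aut_ker_Phi.
Qed.
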